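(* Let $\mathcal Z\subset\mathbb C$ be the set of all roots of unity. The invariant $J_M\in\widehat{\mathbb Z[q]}$ of integral homology spheres is determined by the WRT function $\tau(M):\mathcal Z\to\mathbb C$, $\zeta\mapsto\tau_\zeta(M)$; thus for integral homology spheres $M,M'$ we have $J_M=J_{M'}$ if and only if $\tau(M)=\tau(M')$. Moreover, let $\mathcal Z'\subset\mathcal Z$ be any infinite subset having a limit point. Then both $J_M$ and $\tau(M)$ are determined by the values $\tau_\zeta(M)$ for $\zeta\in\mathcal Z'$: if $M,M'$ are integral homology spheres with $\tau_\zeta(M)=\tau_\zeta(M')$ for all $\zeta\in\mathcal Z'$, then $J_M=J_{M'}$ and $\tau(M)=\tau(M')$.
   Context: Integral homology sphere: closed connected oriented 3-manifold with trivial first integral homology. $\widehat{\mathbb Z[q]}=\varprojlim_n\mathbb Z[q]/((q)_n)$ with $(q)_n=(1-q)(1-q^2)\cdots(1-q^n)$. For a root of unity $\zeta$, $\mathrm{ev}_\zeta:\widehat{\mathbb Z[q]}\to\mathbb Z[\zeta]$ is the ring homomorphism induced by $f(q)\mapsto f(\zeta)$. $\tau_\zeta(M)$ denotes the $SU(2)$ Witten-Reshetikhin-Turaev (WRT) invariant of $M$ at the root of unity $\zeta$ (normalized by $\tau_\zeta(S^3)=1$, and $\tau_1(M)=1$). $J_M\in\widehat{\mathbb Z[q]}$ denotes the unified WRT invariant of integral homology spheres, which satisfies $\mathrm{ev}_\zeta(J_M)=\tau_\zeta(M)$ for every root of unity $\zeta$. Two roots of unity $\zeta,\xi$ are adjacent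 if $\zeta\xi^{-1}$ has prime power order. An element $\xi\in\mathcal Z$ is a limit point of a subset $\mathcal Z'\subset\mathcal Z$ if there are infinitely many $\zeta\in\mathcal Z'$ adjacent to $\xi$. *)

(* Defs.v *)
From HB Require Import structures.
From mathcomp Require Import all_boot all_order all_algebra.
From mathcomp Require Import all_classical all_reals all_analysis.
From mathcomp Require Import complex.

Set Implicit Arguments.
Unset Strict Implicit.
Unset Printing Implicit Defensive.

Import Order.TTheory GRing.Theory Num.Theory.
Import numFieldNormedType.Exports.

Local Open Scope classical_set_scope.
Local Open Scope ring_scope.

(** * The Habiro ring *)

(* (q)_n up to the unit (-1)^n, the sign making it monic. *)
Definition qfact (n : nat) : {poly int} := \prod_(1 <= i < n.+1) ('X^i - 1).

Lemma qfact_monic n : qfact n \is monic.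
Proof.
rewrite /qfact big_nat; apply: monic_prod => i /andP[i0 _].
by rewrite -[1]/(1%:P) monicXnsubC.
Qed.

Lemma qfactS n : qfact n.+1 = qfact n * ('X^(n.+1) - 1).
Proof. by rewrite /qfact big_nat_recr. Qed.

Local Notation rem p n := (Pdiv.Ring.rmodp p (qfact n)).

Lemma rem_rem p n : rem (rem p n.+1) n = rem p n.
Proof.
have mn := qfact_monic n.
rewrite [in RHS](Pdiv.RingMonic.rdivp_eq (qfact_monic n.+1) p).
rewrite (Pdiv.RingMonic.rmodpD mn) qfactS (mulrC (qfact n)) mulrA.
by rewrite (Pdiv.RingMonic.rmodp_mull mn) add0r.
Qed.

(* The inverse limit of Z[q]/((q)_n): the n-th entry is the canonical
   representative (the remainder modulo the monic polynomial above) of the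
   component in Z[q]/((q)_n). *)
Record habiro := Habiro {
  hseq :> nat -> {poly int};
  hseqP : forall n, hseq n = rem (hseq n.+1) n }.

Lemma habiroP (x y : habiro) : hseq x =1 hseq y -> x = y.
Proof.
move=> /funext; case: x y => [x xP] [y yP] /= exy.
by subst y; congr Habiro; exact: Prop_irrelevance.
Qed.

Lemma hseq_rem (x : habiro) n : rem (x n) n = x n.
Proof. by rewrite hseqP (Pdiv.RingMonic.rmodp_id (qfact_monic n)). Qed.

HB.instance Definition _ := gen_eqMixin habiro.
HB.instance Definition _ := gen_choiceMixin habiro.

Lemma habiro_of_polyP (p : {poly int}) n : rem p n = rem (rem p n.+1) n.
Proof. by rewrite rem_rem. Qed.
Definition habiro_of_poly (p : {poly int}) : habiro :=
  Habiro (habiro_of_polyP p).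

Lemma habiro_addP (x y : habiro) n : x n + y n = rem (x n.+1 + y n.+1) n.
Proof. by rewrite (Pdiv.RingMonic.rmodpD (qfact_monic n)) -!hseqP. Qed.
Definition habiro_add x y := Habiro (habiro_addP x y).

Lemma habiro_oppP (x : habiro) n : - x n = rem (- x n.+1) n.
Proof. by rewrite (Pdiv.RingMonic.rmodpN (qfact_monic n)) -hseqP. Qed.
Definition habiro_opp x := Habiro (habiro_oppP x).

Lemma habiro_mulP (x y : habiro) n :
  rem (x n * y n) n = rem (rem (x n.+1 * y n.+1) n.+1) n.
Proof.
have mn := qfact_monic n.
rewrite rem_rem [in LHS](hseqP x) [in LHS](hseqP y).
by rewrite (Pdiv.RingMonic.rmodp_mulml mn) (Pdiv.RingMonic.rmodp_mulmr mn).
Qed.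
Definition habiro_mul x y := Habiro (habiro_mulP x y).

Lemma habiro_addA : associative habiro_add.
Proof. by move=> x y z; apply: habiroP => n /=; rewrite addrA. Qed.
Lemma habiro_addC : commutative habiro_add.
Proof. by move=> x y; apply: habiroP => n /=; rewrite addrC. Qed.
Lemma habiro_add0 : left_id (habiro_of_poly 0) habiro_add.
Proof.
by move=> x; apply: habiroP => n /=; rewrite Pdiv.CommonRing.rmod0p add0r.
Qed.
Lemma habiro_addN : left_inverse (habiro_of_poly 0) habiro_opp habiro_add.
Proof.
by move=> x; apply: habiroP => n /=; rewrite addNr Pdiv.CommonRing.rmod0p.
Qed.
HB.instance Definition _ :=
  GRing.isZmodule.Build habiro habiro_addA habiro_addC habiro_add0 habiro_addN.

Lemma habiro_mulA : associative habiro_mul.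
Proof.
move=> x y z; apply: habiroP => n /=; have mn := qfact_monic n.
rewrite (Pdiv.RingMonic.rmodp_mulmr mn) (Pdiv.RingMonic.rmodp_mulml mn).
by rewrite mulrA.
Qed.
Lemma habiro_mulC : commutative habiro_mul.
Proof. by move=> x y; apply: habiroP => n /=; rewrite mulrC. Qed.
Lemma habiro_mul1 : left_id (habiro_of_poly 1) habiro_mul.
Proof.
move=> x; apply: habiroP => n /=; have mn := qfact_monic n.
by rewrite (Pdiv.RingMonic.rmodp_mulml mn) mul1r hseq_rem.
Qed.
Lemma habiro_mulDl : left_distributive habiro_mul habiro_add.
Proof.
move=> x y z; apply: habiroP => n /=; have mn := qfact_monic n.
by rewrite mulrDl (Pdiv.RingMonic.rmodpD mn).
Qed.
Lemma habiro_neq01 : habiro_of_poly 1 != 0.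
Proof.
apply/eqP => /(congr1 (fun x : habiro => x 1)) /=.
rewrite /qfact big_nat1 Pdiv.CommonRing.rmod0p.
rewrite Pdiv.CommonRing.rmodp_small; first by move/eqP; rewrite oner_eq0.
by rewrite size_poly1 expr1 -polyC1 size_XsubC.
Qed.
HB.instance Definition _ := GRing.Zmodule_isComNzRing.Build habiro
  habiro_mulA habiro_mulC habiro_mul1 habiro_mulDl habiro_neq01.

(** * Roots of unity and evaluation *)

Section Evaluation.
Variable C : numClosedFieldType.

Definition is_root_of_unity (z : C) := exists2 n, (0 < n)%N & z ^+ n = 1.

Definition root_order (z : C) : nat :=
  xget 0%N [set n | n.-primitive_root z].

Definition poly_ev (z : C) (p : {poly int}) : C := (map_poly intr p).[z].

(* f(z) only depends on f modulo (q)_n as soon as n is at least the order of z,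
   since (q)_n then vanishes at z; see ev_eq. *)
Definition ev (z : C) (x : habiro) : C := poly_ev z (x (root_order z)).

Lemma poly_ev_qfact z n m : (0 < m <= n)%N -> z ^+ m = 1 ->
  poly_ev z (qfact n) = 0.
Proof.
move=> /andP[m0 mn] zm; rewrite /poly_ev /qfact rmorph_prod horner_prod.
rewrite (big_rem m) /=; last by rewrite mem_index_iota m0.
rewrite rmorphB /= map_polyXn rmorph1 !hornerE zm subrr.
by rewrite mul0r.
Qed.

Lemma poly_ev_rem z n m p : (0 < m <= n)%N -> z ^+ m = 1 ->
  poly_ev z (rem p n) = poly_ev z p.
Proof.
move=> mn zm; rewrite [in RHS](Pdiv.RingMonic.rdivp_eq (qfact_monic n) p).
rewrite /poly_ev rmorphD rmorphM /= hornerD hornerM.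
by rewrite -/(poly_ev z (qfact n)) (poly_ev_qfact mn zm) mulr0 add0r.
Qed.

Lemma root_orderP z : is_root_of_unity z -> (root_order z).-primitive_root z.
Proof.
move=> [n n0 zn]; rewrite /root_order; case: xgetP => [m _ //|].
have [m mz _] := prim_order_exists n0 zn.
by move=> /(_ m).
Qed.

Lemma ev_eq z x n : is_root_of_unity z -> (root_order z <= n)%N ->
  ev z x = poly_ev z (x n).
Proof.
move=> zZ; have pz := root_orderP zZ; elim: n => [|n IH] le_n.
  by rewrite /ev; move: le_n; rewrite leqn0 => /eqP ->.
move: le_n; rewrite leq_eqVlt => /orP[/eqP <- //|]; rewrite ltnS => le_n.
rewrite IH // [x n]hseqP; apply: (@poly_ev_rem z n (root_order z)).
  by rewrite (prim_order_gt0 pz).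
exact: prim_expr_order.
Qed.

Lemma ev_of_poly z p : is_root_of_unity z ->
  ev z (habiro_of_poly p) = poly_ev z p.
Proof.
move=> zZ; have pz := root_orderP zZ.
apply: (@poly_ev_rem _ _ (root_order z)); last exact: prim_expr_order.
by rewrite (prim_order_gt0 pz) /=.
Qed.

Lemma evD z : {morph ev z : x y / x + y}.
Proof. by move=> x y; rewrite /ev /poly_ev rmorphD hornerD. Qed.

Lemma evM z x y : is_root_of_unity z -> ev z (x * y) = ev z x * ev z y.
Proof.
move=> zZ; have pz := root_orderP zZ.
rewrite {1}/ev (@poly_ev_rem _ _ (root_order z)); last exact: prim_expr_order.
  by rewrite /poly_ev rmorphM hornerM.
by rewrite (prim_order_gt0 pz) /=.
Qed.

Definition adjacent (z w : C) := exists p k,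
  [/\ prime p, (0 < k)%N & (p ^ k)%N.-primitive_root (z / w)].

Definition adjacency_limit_point (Z : set C) (w : C) :=
  is_root_of_unity w /\ infinite_set [set z | Z z /\ adjacent z w].

End Evaluation.

(** * Link diagrams on the square grid *)

(* A diagram drawn on the grid N x N.  The edge (true, (x, y)) joins (x, y) to
   (x, y+1) and the edge (false, (x, y)) joins (x, y) to (x+1, y).  Four edges
   meet at a crossing, where the vertical strand passes over the horizontal one;
   every link has such a diagram. *)
Definition edge (N : nat) : Type := (bool * ('I_N * 'I_N))%type.

Definition endpoint N (e : edge N) (far : bool) : nat * nat :=
  ((e.2.1 + (~~ e.1 && far))%N, (e.2.2 + (e.1 && far))%N).

Section Grid.
Variables (N : nat) (V H : nat -> nat -> bool).

Definition present (e : edge N) : bool :=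
  if e.1 then V e.2.1 e.2.2 else H e.2.1 e.2.2.

Definition is_crossing (p : nat * nat) : bool :=
  [&& V p.1 p.2, (0 < p.2)%N, V p.1 p.2.-1,
      H p.1 p.2, (0 < p.1)%N & H p.1.-1 p.2].

Definition crossings : {set 'I_N * 'I_N} :=
  [set p : 'I_N * 'I_N | is_crossing (p.1 : nat, p.2 : nat)].

(* Edge ends meeting at a point that is not a crossing are joined; at a
   crossing p, c p says which of them are. *)
Definition join (c : nat * nat -> rel (bool * bool)) : rel (edge N) :=
  fun e e' => [&& present e, present e' &
    [exists far, exists far',
      (endpoint e far == endpoint e' far') &&
      (is_crossing (endpoint e far) ==>
         c (endpoint e far) (e.1, far) (e'.1, far'))]].

Definition straight (p : nat * nat) : rel (bool * bool) :=
  fun d d' => d.1 == d'.1.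

(* Rotating the (vertical) overstrand counterclockwise sweeps the north-west and
   south-east regions.  The A-smoothing, taken at the crossings in s, merges
   them: it joins north to east and south to west. *)
Definition smoothing (s : {set 'I_N * 'I_N}) (p : nat * nat) :
    rel (bool * bool) :=
  fun d d' => (d.1 != d'.1) &&
    ((d.2 == d'.2) == [exists q in s, (q.1 : nat, q.2 : nat) == p]).

Definition strand : rel (edge N) := join straight.

Definition loops (s : {set 'I_N * 'I_N}) : nat :=
  n_comp (join (smoothing s)) [pred e | present e].

End Grid.

(* Blackboard cable: the strand through an edge e is replaced by mu e parallel
   strands.  Each grid point is blown up to a K x K block (mu <= K), in which the
   a-th vertical line continues, at a corner, into the horizontal line a or
   mu - 1 - a, according to the shape of the corner. *)
Section Cable.
Variables (K : nat) (V H : nat -> nat -> bool) (mu : bool -> nat -> nat -> nat).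

Definition cableV (X Y : nat) : bool :=
  let x := (X %/ K)%N in let a := (X %% K)%N in
  let y := (Y %/ K)%N in let t := (Y %% K)%N in
  let n := V x y in let s := (0 < y)%N && V x y.-1 in let e := H x y in
  let k := if n then mu true x y else mu true x y.-1 in
  let c := if n == e then a else (k - a.+1)%N in
  (a < k)%N && (if n then s || (c <= t)%N else s && (t < c)%N).

Definition cableH (X Y : nat) : bool :=
  let x := (X %/ K)%N in let t := (X %% K)%N in
  let y := (Y %/ K)%N in let b := (Y %% K)%N in
  let e := H x y in let w := (0 < x)%N && H x.-1 y in let n := V x y in
  let k := if e then mu false x y else mu false x.-1 y in
  let c := if n == e then b else (k - b.+1)%N in
  (b < k)%N && (if e then w || (c <= t)%N else w && (t < c)%N).

End Cable.

Definition vertex_ok (n s e w : int) : bool :=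
  let deg := count (fun a => a != 0) [:: n; s; e; w] in
  [|| deg == 0%N, (deg == 2%N) && (s + w == n + e)
    | [&& deg == 4%N, n == s & e == w]].

(* Oriented diagrams: dV x y is 1 if the edge from (x, y) to (x, y+1) is present
   and oriented upwards, -1 if it is oriented downwards, and 0 if it is absent;
   dH is 1 for edges oriented to the right. *)
Record diagram := Diagram {
  dsize : nat;
  dV : nat -> nat -> int;
  dH : nat -> nat -> int;
  dV_sign : forall x y, dV x y \in [:: -1; 0; 1];
  dH_sign : forall x y, dH x y \in [:: -1; 0; 1];
  dV_bound : forall x y, dV x y != 0 -> (x < dsize)%N && (y < dsize)%N;
  dH_bound : forall x y, dH x y != 0 -> (x < dsize)%N && (y < dsize)%N;
  d_vertex : forall x y,
    vertex_ok (dV x y) (if y is y'.+1 then dV x y' else 0)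
              (dH x y) (if x is x'.+1 then dH x' y else 0) }.

Section DiagramData.
Variable D : diagram.

Definition vert (x y : nat) : bool := dV D x y != 0.
Definition horz (x y : nat) : bool := dH D x y != 0.
Definition dedge : finType := edge (dsize D).
Definition dpresent (e : dedge) : bool := present vert horz e.
Definition dcrossing : nat * nat -> bool := is_crossing vert horz.

(* The components of the link, each represented by one of its edges. *)
Definition comp_of (e : dedge) : dedge := fingraph.root (@strand (dsize D) vert horz) e.
Definition comps : {set dedge} := [set e | dpresent e && (comp_of e == e)].

(* Signed number of crossings of i over j; a crossing is positive when the
   understrand is obtained from the overstrand by a counterclockwise turn. *)
Definition inter (i j : dedge) : int :=
  \sum_(p in crossings (dsize D) vert horz
         | (comp_of (true, p) == i) && (comp_of (false, p) == j))
     - (dV D p.1 p.2 * dH D p.1 p.2).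

Definition writhe (i : dedge) : int := inter i i.

End DiagramData.

(** * The SU(2) WRT invariant of surgery along a blackboard framed link *)

Section Skein.
Variable C : numClosedFieldType.

Definition loop_value (A : C) : C := - A ^+ 2 - A ^- 2.

(* Kauffman bracket, equal to 1 on the empty diagram. *)
Definition bracket (A : C) (N : nat) (V H : nat -> nat -> bool) : C :=
  \sum_(s : {set 'I_N * 'I_N} | s \subset crossings N V H)
     A ^+ #|s| * A ^- #|crossings N V H :\: s|
       * loop_value A ^+ loops V H s.

(* Closure of the n-th Jones-Wenzl idempotent in the skein algebra C[X] of the
   solid torus, X being the core. *)
Fixpoint chebS (n : nat) : {poly C} :=
  match n with
  | 0 => 1
  | 1 => 'X
  | (m.+1 as m').+1 => 'X * chebS m' - chebS m
  end.

Definition omega (r : nat) (A : C) : {poly C} :=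
  \sum_(n < r.-1) (chebS n).[loop_value A] *: chebS n.

(* A component carrying X^m is replaced by its m-fold cable. *)
Definition is_coloring (D : diagram) r (m : {ffun dedge D -> 'I_r}) : bool :=
  [forall e, if dpresent e then m e == m (comp_of e) else m e == 0%N :> nat].

Definition mult (D : diagram) r (m : {ffun dedge D -> 'I_r})
    (b : bool) (x y : nat) : nat :=
  \sum_(e : dedge D | [&& e.1 == b, e.2.1 == x :> nat & e.2.2 == y :> nat]) m e.

Definition omega_bracket (r : nat) (A : C) (D : diagram) : C :=
  \sum_(m : {ffun dedge D -> 'I_r} | is_coloring m)
     (\prod_(i in comps D) (omega r A)`_(m i))
     * bracket A (dsize D * r) (cableV r (vert D) (horz D) (mult m))
                               (cableH r (vert D) (horz D) (mult m)).

(* omega_bracket of the unknot with framing 1; for framing -1 take A^-1. *)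
Definition omega_unknot (r : nat) (A : C) : C :=
  \sum_(n < r.-1)
     (chebS n).[loop_value A] ^+ 2 * (-1) ^+ n * A ^+ (n * n.+2).

Definition linking_matrix (D : diagram) : 'M[C]_#|comps D| :=
  \matrix_(a, b) ((inter (enum_val a) (enum_val b)
                   + inter (enum_val b) (enum_val a))%:~R / 2).

Definition eigenvalues n (M : 'M[C]_n) : seq C :=
  sval (closed_field_poly_normal (char_poly M)).

Definition pos_index n (M : 'M[C]_n) := count (fun a => 0 < a) (eigenvalues M).
Definition neg_index n (M : 'M[C]_n) := count (fun a => a < 0) (eigenvalues M).

Definition surgery_invariant (r : nat) (A : C) (D : diagram) : C :=
  omega_bracket r A D /
    (omega_unknot r A ^+ pos_index (linking_matrix D)
     * omega_unknot r A^-1 ^+ neg_index (linking_matrix D)).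

End Skein.

(** * Singular homology and integral homology spheres *)

Section Topology.
Variable R : realType.

Definition simplex (n : nat) : set 'rV[R]_n.+1 :=
  [set x | (forall j, 0 <= x 0 j) /\ \sum_j x 0 j = 1].

Definition open_simplex (n : nat) : set 'rV[R]_n.+1 :=
  [set x | (forall j, 0 < x 0 j) /\ \sum_j x 0 j = 1].

Local Arguments simplex n _ : clear implicits.
Local Arguments open_simplex n _ : clear implicits.

Definition face (n : nat) (i : 'I_n.+2) (x : 'rV[R]_n.+1) : 'rV[R]_n.+2 :=
  \row_j (if unlift i j is Some k then x 0 k else 0).

Section Chains.
Variable T : topologicalType.

(* Formal sums of maps, which only matter on the standard simplex. *)
Definition chain (n : nat) : Type := seq (int * ('rV[R]_n.+1 -> T)).

Definition coeff n (c : chain n) (s : 'rV[R]_n.+1 -> T) : int :=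
  \sum_(a <- c | `[< {in simplex n, a.2 =1 s} >]) a.1.

Definition null n (c : chain n) : Prop := forall s, coeff c s = 0.

Definition scale n (k : int) (c : chain n) : chain n :=
  [seq (k * a.1, a.2) | a <- c].

Definition minus n (c c' : chain n) : chain n := c ++ scale (-1) c'.

Definition boundary n (c : chain n.+1) : chain n :=
  [seq ((-1) ^+ i * a.1, a.2 \o face i) | a <- c, i : 'I_n.+2 <- enum 'I_n.+2].

Definition chain_in n (A : set T) (c : chain n) : Prop :=
  {in c, forall a,
    {within simplex n, continuous a.2} /\ a.2 @` simplex n `<=` A}.

(* Equality of classes in H_n(A, B). *)
Definition homologous n (A B : set T) (c c' : chain n) : Prop :=
  exists (b : chain n.+1) (z : chain n),
    [/\ chain_in A b, chain_in B z &
        null (minus (minus c c') (boundary b ++ z))].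

Definition H1_trivial : Prop :=
  forall c : chain 1, chain_in setT c -> null (boundary c) ->
    homologous setT set0 c [::].

Definition rel_cycle (x : T) (c : chain 3) : Prop :=
  chain_in setT c /\
  exists z : chain 2, chain_in (~` [set x]) z /\ null (minus (boundary c) z).

Definition local_generator (x : T) (c : chain 3) : Prop :=
  rel_cycle x c /\
  forall c', rel_cycle x c' ->
    exists k : int, homologous setT (~` [set x]) c' (scale k c).

(* o x represents a generator of H_3(T, T \ x), locally constant in x. *)
Definition orientation (o : T -> chain 3) : Prop :=
  (forall x, local_generator x (o x)) /\
  (forall x, exists (U : set T) (c : chain 3),
     [/\ open_nbhs x U, chain_in setT c &
         forall y, U y -> homologous setT (~` [set y]) c (o y)]).

Definition locally_euclidean3 : Prop :=
  forall x, exists (U : set T) (f : T -> 'rV[R]_3),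
    [/\ open_nbhs x U, {within U, continuous f}, set_inj U f &
        forall W, open W -> W `<=` U -> open (f @` W)].

End Chains.

Record integral_homology_sphere := IntegralHomologySphere {
  carrier :> topologicalType;
  orient : carrier -> chain carrier 3;
  ihs_nonempty : [set: carrier] !=set0;
  ihs_compact : compact [set: carrier];
  ihs_hausdorff : hausdorff_space carrier;
  ihs_connected : connected [set: carrier];
  ihs_locally_euclidean : locally_euclidean3 carrier;
  ihs_orientation : orientation orient;
  ihs_H1 : H1_trivial carrier }.

(** * Dehn surgery *)

(* The affine simplex with vertices the rows of v. *)
Definition affine n (v : 'M[R]_(n.+1, 3)) (x : 'rV[R]_n.+1) : 'rV[R]_3 :=
  x *m v.

Definition positive_simplex (v : 'M[R]_(4, 3)) : Prop :=
  0 < \det (\matrix_(i < 3) (row (lift ord0 i) v - row ord0 v)).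

Definition point (x y z : R) : 'rV[R]_3 := \row_(j < 3) [:: x; y; z]`_j.

(* Spatial realisation of the component i: vertical edges at height 1 and
   horizontal edges at height 0, connected at the corners. *)
Definition component (D : diagram) (i : dedge D) : set 'rV[R]_3 :=
  [set p | exists e, [/\ dpresent e, comp_of e = i & exists2 t : R, 0 <= t <= 1 &
     p = if e.1 then point e.2.1%:R (e.2.2%:R + t) 1
         else point (e.2.1%:R + t) e.2.2%:R 0]]
  `|`
  [set p | exists (e e' : dedge D) far far',
     [/\ dpresent e && dpresent e', e.1 && ~~ e'.1, comp_of e = i,
         endpoint e far = endpoint e' far' /\ ~~ dcrossing D (endpoint e far)
       & exists2 t : R, 0 <= t <= 1 &
           p = point (endpoint e far).1%:R (endpoint e far).2%:R t]].

Definition circ (t : R) : R * R := (cos (2 * pi * t), sin (2 * pi * t)).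
Definition disc : set (R * R) := [set u | u.1 ^+ 2 + u.2 ^+ 2 <= 1].
Definition open_disc : set (R * R) := [set u | u.1 ^+ 2 + u.2 ^+ 2 < 1].

(* f : S^1 x R^2 -> R^3, with S^1 = R/Z, has core curve f(-, 0).  Its longitude
   f(-, (1, 0)) has linking number k with the core when it is homologous, in the
   complement of the core, to k times the boundary of a triangle v that the core
   crosses once, in the positive direction. *)
Definition has_framing (f : R -> R * R -> 'rV[R]_3) (k : int) : Prop :=
  let core := [set f t (0, 0) | t in [set: R]] in
  exists (t0 : R) (d : 'rV[R]_3) (v : 'M[R]_(3, 3)),
    [/\ is_derive t0 1 (fun t => f t (0, 0)) d,
        positive_simplex (col_mx v (row ord0 v + d)),
        (affine v @` open_simplex 2) (f t0 (0, 0)),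
        (affine v @` simplex 2) `&` core = [set f t0 (0, 0)] &
        homologous (~` core) set0
          [:: (1, fun x : 'rV[R]_2 => f (x 0 ord_max) (1, 0))]
          (scale k (boundary [:: (1, affine v)]))].

(* phi i (-, u) with |u| <= 1 parametrises a solid torus around the component i;
   the extension to all u makes its boundary bicollared. *)
Definition tubular (D : diagram) (phi : dedge D -> R -> R * R -> 'rV[R]_3) :
    Prop :=
  [/\ {in comps D, forall i, continuous (fun p : R * (R * R) => phi i p.1 p.2)},
      {in comps D &, forall i j t u t' u', phi i t u = phi j t' u' <->
         [/\ i = j, t - t' \is a Num.int & u = u']},
      {in comps D, forall i,
         [set phi i t (0, 0) | t in [set: R]] = component i} &
      {in comps D, forall i, has_framing (phi i) (writhe i)}].

Definition S3 : topologicalType := one_point_compactification 'rV[R]_3.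

Definition exterior (D : diagram) (phi : dedge D -> R -> R * R -> 'rV[R]_3) :
    set S3 :=
  ~` [set x | exists i t u,
        [/\ i \in comps D, open_disc u & x = Some (phi i t u)]].

(* M is the union of the image of the link exterior under f and of solid tori
   D^2 x S^1, parametrised by the psi i, where (circ t, s) is glued to
   phi i t (circ s); hence meridian discs are glued along longitudes, that is,
   along the blackboard framing.  M being compact and Hausdorff, it is
   homeomorphic to the glued space, and f preserves orientations. *)
Definition surgery_presentation (M : topologicalType) (o : M -> chain M 3)
    (D : diagram) : Prop :=
  exists (phi : dedge D -> R -> R * R -> 'rV[R]_3) (f : S3 -> M)
         (psi : dedge D -> R * R -> R -> M),
    let X := exterior phi in
    tubular phi /\
    [/\ {within X, continuous f} /\ set_inj X f,
        {in comps D, forall i, {within [set p : (R * R) * R | disc p.1],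
           continuous (fun p => psi i p.1 p.2)}},
        {in comps D &, forall i j u s u' s', disc u -> disc u' ->
           psi i u s = psi j u' s' <->
           [/\ i = j, u = u' & s - s' \is a Num.int]},
        {in comps D, forall i x u s, X x -> disc u -> f x = psi i u s <->
           exists2 t, u = circ t & x = Some (phi i t (circ s))} &
        forall y, (f @` X) y \/
          exists i u s, [/\ i \in comps D, disc u & y = psi i u s]]
    /\
    forall (v : 'M[R]_(4, 3)) (x : 'rV[R]_4),
      positive_simplex v -> open_simplex 3 x ->
      Some @` (affine v @` simplex 3) `<=` X ->
      let y := f (Some (affine v x)) in
      homologous setT (~` [set y])
        [:: (1, fun z => f (Some (affine v z)))] (o y).

(* The SU(2) WRT invariant at a root of unity z of order r > 1, computed from any
   surgery presentation and any fourth root A of z of order 4r; the value does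
   not depend on these choices (Reshetikhin-Turaev, Kirby-Melvin, Lickorish). *)
Definition wrt (M : integral_homology_sphere) (z : R[i]) : R[i] :=
  if z == 1 then 1 else
  xget 0 [set t | exists D r (A : R[i]),
    [/\ surgery_presentation (@orient M) D, (1 < r)%N,
        (4 * r)%N.-primitive_root A, A ^+ 4 = z & t = surgery_invariant r A D]].

(* The unified WRT invariant J_M, characterised by its evaluations. *)
Definition unified_wrt (J : integral_homology_sphere -> habiro) : Prop :=
  forall M (z : R[i]), is_root_of_unity z -> ev z (J M) = wrt M z.

End Topology.

(* Main.v *)
(**
  Two elements of the Habiro ring with the same evaluations at all roots in
  [Z'] have a difference [x] that vanishes there, and we show [x = 0].  If [z] is
  adjacent to [w], of order [n], and has order [m > n], then [m = n p^b] for a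
  prime [p], and the cyclotomic polynomial [Phi_m] lies in the ideal
  [(p, Phi_n)] of [Z[q]].  As infinitely many such [Phi_m] divide [x], the class
  of [x] modulo [Phi_n] is divisible by products of arbitrarily many primes,
  hence is zero; dividing by [Phi_n] and iterating, every power of [Phi_n]
  divides [x].

  Infinite divisibility propagates: if a power of [a] lies in [(p, b)] and all
  powers of [a] divide [x], then [x] modulo [b^t] is divisible by all powers of
  [p], so all powers of [b] divide [x].  Since [Phi_{mp}] is in [(p, Phi_m)] one
  descends from [Phi_n] to [q - 1], and since [(q^m - 1)^p] is in
  [(p, q^{mp} - 1)] one climbs from [q - 1] to every [q^m - 1].  Each [(q)_k]
  divides a power of some [q^m - 1], so [x = 0].
*)

Require Import Defs.
From mathcomp Require Import all_boot all_order all_algebra all_field.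
From mathcomp Require Import all_classical all_reals all_analysis.
From mathcomp Require Import complex.
From mathcomp Require Import ring zify.

Set Implicit Arguments.
Unset Strict Implicit.
Unset Printing Implicit Defensive.

Import Order.TTheory GRing.Theory Num.Theory.

Local Open Scope classical_set_scope.
Local Open Scope ring_scope.

(** * Divisibility in Z[q] *)

(* [%|] on [{poly int}] is pseudo-divisibility, i.e. divisibility over the
   rationals. *)
Definition divides (d p : {poly int}) := exists q, p = q * d.

Lemma divides_trans (a b c : {poly int}) : divides a b -> divides b c -> divides a c.
Proof. by move=> [q ->] [q' ->]; exists (q' * q); rewrite mulrA. Qed.

Lemma divides_mulr (a b c : {poly int}) : divides a b -> divides a (b * c).
Proof. by move=> [q ->]; exists (q * c); rewrite mulrAC. Qed.

Lemma dividesB (a b c : {poly int}) : divides a b -> divides a c -> divides a (b - c).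
Proof. by move=> [q ->] [q' ->]; exists (q - q'); rewrite mulrBl. Qed.

Lemma divides_exp (a b : {poly int}) n : divides a b -> divides (a ^+ n) (b ^+ n).
Proof. by move=> [q ->]; exists (q ^+ n); rewrite exprMn. Qed.

Lemma dividesP (d p : {poly int}) : d \is monic ->
  divides d p <-> Pdiv.Ring.rmodp p d = 0.
Proof.
move=> md; split => [[q ->]|H]; first by rewrite Pdiv.RingMonic.rmodp_mull.
exists (Pdiv.Ring.rdivp p d).
by rewrite [LHS](Pdiv.RingMonic.rdivp_eq md) H addr0.
Qed.

(** Division by a monic polynomial stays integral, so a nonzero remainder would be a rational
    multiple of [d] of smaller degree than [d]. *)
Lemma divides_rat (d p : {poly int}) : d \is monic ->
  (map_poly intr d : {poly rat}) %| map_poly intr p -> divides d p.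
Proof.
move=> md; rewrite (Pdiv.RingMonic.rdivp_eq md p).
set q := Pdiv.Ring.rdivp p d; set r := Pdiv.Ring.rmodp p d.
rewrite rmorphD rmorphM /= dvdp_addr ?dvdp_mull // => dr.
suff -> : r = 0 by exists q; rewrite addr0.
apply/eqP; apply/negPn/negP => r0.
have inj : injective (intr : int -> rat) by exact: intr_inj.
have /dvdp_leq /(_ dr) : map_poly (intr : int -> rat) r != 0.
  by rewrite -size_poly_eq0 size_map_inj_poly // size_poly_eq0.
rewrite !size_map_inj_poly // leqNgt.
by rewrite (@Pdiv.CommonRing.ltn_rmodpN0 _ p d) // monic_neq0.
Qed.

(* The remainder of p by d has coefficients divisible by arbitrarily large N. *)
Lemma divides_adic (d p : {poly int}) : d \is monic ->
  (forall s, exists N q w, (s < N)%N /\ p = q * d + w * N%:R) -> divides d p.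
Proof.
move=> md H; apply/dividesP => //; apply/polyP => i; rewrite coef0.
set r := Pdiv.Ring.rmodp p d.
have [N [q [w [lN pE]]]] := H (absz r`_i).
have: r = Pdiv.Ring.rmodp w d *+ N.
  rewrite /r pE mulr_natr Pdiv.RingMonic.rmodpD // Pdiv.RingMonic.rmodp_mull // add0r.
  by rewrite -!scaler_nat Pdiv.RingMonic.rmodpZ.
(* [N] was chosen larger than the absolute value of this coefficient, which it divides. *)
move=> /(congr1 (fun t : {poly int} => t`_i)); rewrite coefMn => E.
apply/eqP; rewrite -absz_eq0; move: lN; rewrite E -mulr_natr abszM natz absz_nat.
by case: (absz _) => // k; rewrite mulSn ltnNge leq_addr.
Qed.

(** * Roots of cyclotomic polynomials *)

Lemma root_Cyclotomic_expr (F : fieldType) n (z : F) :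
  (0 < n)%N -> root (map_poly intr 'Phi_n) z -> z ^+ n = 1.
Proof.
move=> n0 rn; have := prod_Cyclotomic n0.
rewrite (big_rem n) /= -?dvdn_divisors // => /(congr1 (map_poly (intr : int -> F))).
rewrite rmorphM rmorphB rmorph1 /= map_polyXn => /(congr1 (horner^~ z)).
rewrite hornerM (rootP rn) mul0r !hornerE => /esym/eqP.
by rewrite subr_eq0 => /eqP.
Qed.

Lemma map_Cyclotomic_root (F : fieldType) n (z : F) :
  n.-primitive_root z -> root (map_poly intr 'Phi_n) z.
Proof.
move=> pz; have n0 := prim_order_gt0 pz.
have : root (map_poly (intr : int -> F) (\prod_(d <- divisors n) 'Phi_d)) z.
  rewrite prod_Cyclotomic // rmorphB rmorph1 /= map_polyXn /root !hornerE.
  by rewrite (prim_expr_order pz) subrr.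
rewrite rmorph_prod /= /root horner_prod prodf_seq_eq0 => /hasP[d].
rewrite -dvdn_divisors // /= => dn rd.
have d0 : (0 < d)%N by apply: dvdn_gt0 dn.
have /eqP := root_Cyclotomic_expr d0 rd; rewrite -(prim_order_dvd pz) => nd.
by have /eqP -> : n == d by rewrite eqn_dvd nd.
Qed.

(** The common root [z] makes the rational gcd of [p] and ['Phi_n] nonconstant. A root of this gcd
    in [algC] is a primitive n-th root of unity, and its minimal polynomial ['Phi_n] then divides
    [p]. *)
Lemma Cyclotomic_divides (F : numClosedFieldType) n (z : F) p :
  n.-primitive_root z -> poly_ev z p = 0 -> divides 'Phi_n p.
Proof.
move=> pz pz0; apply: divides_rat; first exact: Cyclotomic_monic.
set P := map_poly _ p; set Q := map_poly _ _.
have EC (G : numClosedFieldType) (f : {poly int}) :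
    map_poly ratr (map_poly intr f : {poly rat}) = map_poly intr f :> {poly G}.
  by rewrite -map_poly_comp; apply: eq_map_poly => b; rewrite /= rmorph_int.
have [/Bezout_coprimepP[[u v] /= uv]|ncop] := boolP (coprimep P Q).
  exfalso; have /negP[] : ~~ root (map_poly (ratr : rat -> F) (u * P + v * Q)) z.
    move: uv; rewrite -(eqp_map (ratr : {rmorphism rat -> F})) rmorph1.
    by move=> /eqp_root ->; rewrite root1.
  rewrite rmorphD !rmorphM /= !EC /root !hornerE -/(poly_ev z p) pz0.
  by rewrite (rootP (map_Cyclotomic_root pz)) !mulr0 addr0.
have Q0 : Q != 0.
  rewrite -size_poly_eq0 size_map_inj_poly //; last exact: intr_inj.
  by rewrite size_poly_eq0 monic_neq0 // Cyclotomic_monic.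
have [a] : exists a : algC, root (map_poly ratr (gcdp P Q)) a.
  apply/closed_rootP.
  by rewrite size_map_poly; move: ncop; rewrite /coprimep.
rewrite gcdp_map root_gcd => /andP[].
have n0 := prim_order_gt0 pz.
have [b pb] := C_prim_root_exists n0.
rewrite [X in _ -> root X _ -> _]EC (Cintr_Cyclotomic pb) => aP.
rewrite root_cyclotomic // => pa.
have [f [fE _] fdv] := minCpolyP a.
suff -> : Q = f by rewrite -fdv.
apply: (map_poly_inj (ratr : {rmorphism rat -> algC})) => /=.
by rewrite EC -fE (minCpoly_cyclotomic pa) (Cintr_Cyclotomic pa).
Qed.

Lemma prim_order_inj (F : fieldType) m n (z : F) :
  m.-primitive_root z -> n.-primitive_root z -> m = n.
Proof.
move=> pm pn; apply/eqP; rewrite eqn_dvd (prim_order_dvd pm) (prim_order_dvd pn).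
by rewrite (prim_expr_order pm) (prim_expr_order pn) eqxx.
Qed.

(** If [z] has order d, then ['Phi_d] divides ['Phi_n], so a primitive d-th root in [algC] is also a
    primitive n-th root, and d = n. *)
Lemma root_Cyclotomic_prim (F : numClosedFieldType) n (z : F) :
  (0 < n)%N -> root (map_poly intr 'Phi_n) z -> n.-primitive_root z.
Proof.
move=> n0 rz; have [d pd dn] := prim_order_exists n0 (root_Cyclotomic_expr n0 rz).
have [q nE] := Cyclotomic_divides pd (rootP rz).
have [a pa] := C_prim_root_exists (prim_order_gt0 pd).
have [b pb] := C_prim_root_exists n0.
suff pna : n.-primitive_root a by rewrite (prim_order_inj pna pa).
rewrite -(root_cyclotomic pb) -(Cintr_Cyclotomic pb) nE rmorphM rootM.
by rewrite map_Cyclotomic_root ?orbT.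
Qed.

(** * Congruences modulo a prime *)

Lemma Fp_eq0_divides p (f : {poly int}) : prime p ->
  map_poly intr f = 0 :> {poly 'F_p} -> exists v, f = v *+ p.
Proof.
move=> pp f0; exists (\poly_(i < size f) (f`_i %/ p)%Z).
apply/polyP => i; rewrite coefMn coef_poly.
case: ltnP => [_|/(nth_default 0) -> //]; last by rewrite mul0rn.
rewrite -mulr_natr natz divzK // (dvdz_pcharf (pchar_Fp pp)).
by rewrite -coef_map f0 coef0.
Qed.

(** Over ['F_p] the p-th power map is additive and multiplicative and fixes the coefficients. *)
Lemma comp_polyXn_Frobenius p (f : {poly int}) : prime p ->
  exists v, f \Po 'X^p = f ^+ p + v * p%:R.
Proof.
move=> pp; suff : map_poly intr (f \Po 'X^p - f ^+ p) = 0 :> {poly 'F_p}.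
  move=> /(Fp_eq0_divides pp)[v /eqP]; rewrite subr_eq addrC => /eqP ->.
  by exists v; rewrite mulr_natr.
have pX : p \in [pchar {poly 'F_p}] by rewrite (rmorph_pchar polyC) ?pchar_Fp.
rewrite rmorphB rmorphXn /= map_comp_poly map_polyXn.
apply/eqP; rewrite subr_eq0; apply/eqP; elim/poly_ind: (map_poly _ f) => [|g c IH].
  by rewrite comp_poly0 expr0n; case: p pp {pX}.
rewrite comp_polyD comp_polyM comp_polyX comp_polyC IH.
rewrite -(pFrobenius_autE pX (g * 'X + c%:P)) rmorphD rmorphM /= !pFrobenius_autE.
have -> // : c%:P ^+ p = c%:P by rewrite -polyC_exp -[in RHS](expf_card c) card_Fp.
Qed.

(* Membership of A in the ideal (p, B) of Z[X]. *)
Definition pideal p (B A : {poly int}) := exists u v, A = u * B + v * p%:R.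

Lemma pideal_trans p A B C : pideal p C B -> pideal p B A -> pideal p C A.
Proof.
move=> [u [v ->]] [u' [v' ->]]; exists (u' * u), (u' * v + v').
by ring.
Qed.

Lemma pideal_XnM1 p n : prime p -> pideal p ('X^(n * p) - 1) (('X^n - 1) ^+ p).
Proof.
move=> pp; have [v] := comp_polyXn_Frobenius ('X^n - 1) pp.
rewrite comp_polyB comp_Xn_poly -exprM mulnC comp_polyC => E.
by exists 1, (- v); rewrite mul1r E mulNr addrK.
Qed.

Lemma Cyclotomic_comp_divides n p : (0 < n)%N -> prime p ->
  divides 'Phi_(n * p) ('Phi_n \Po 'X^p).
Proof.
move=> n0 pp; have p0 := prime_gt0 pp.
have [z pz] : {z : algC | (n * p).-primitive_root z}.
  by apply: C_prim_root_exists; rewrite muln_gt0 n0.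
apply: (Cyclotomic_divides pz).
rewrite /poly_ev map_comp_poly map_polyXn horner_comp hornerXn.
apply/rootP/map_Cyclotomic_root.
have := exp_prim_root pz p.
by rewrite (gcdn_idPl (dvdn_mull _ (dvdnn _))) mulnK.
Qed.

Lemma monic_size1 (q : {poly int}) : q \is monic -> size q = 1%N -> q = 1.
Proof.
move=> mq /eqP; rewrite size_poly_eq1 => /eqP.
move: mq => /monicP; move=> H /eqP; rewrite -size_poly_eq1 => /size_poly1P[c c0 E].
by move: H; rewrite E lead_coefC => ->.
Qed.

(* Phi_n(X^p) equals Phi_{np} if p divides n, and Phi_{np} Phi_n otherwise, and
   it is congruent to Phi_n^p modulo p. *)
Lemma pideal_Cyclotomic n p : (0 < n)%N -> prime p -> pideal p 'Phi_n 'Phi_(n * p).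
Proof.
move=> n0 pp; have p0 := prime_gt0 pp; have p1 := prime_gt1 pp.
set G := 'Phi_n \Po 'X^p.
have sX : (1 < size ('X^p : {poly int}))%N by rewrite size_polyXn.
have mG : G \is monic.
  rewrite monicE lead_coef_comp // lead_coefXn expr1n mulr1.
  exact: Cyclotomic_monic.
have sG : size G = (totient n * p).+1.
  have := size_comp_poly 'Phi_n 'X^p; rewrite -/G size_Cyclotomic size_polyXn /= => <-.
  by rewrite prednK // size_poly_gt0 monic_neq0.
have [v GE] := comp_polyXn_Frobenius 'Phi_n pp; rewrite -/G in GE.
have [Q GQ] := Cyclotomic_comp_divides n0 pp; rewrite -/G in GQ.
have mn := Cyclotomic_monic n; have mnp := Cyclotomic_monic (n * p).
have mQ : Q \is monic by rewrite -(monicMr _ mnp) -GQ.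
have [pn|pn] := boolP (p %| n)%N.
  (* [G] and ['Phi_(n * p)] have the same degree, as totient(n p) = p totient(n) when p divides
     n. *)
  have Q1 : Q = 1.
    apply: monic_size1 => //; move: sG; rewrite GQ size_Mmonic ?monic_neq0 //.
    rewrite size_Cyclotomic addnS /= => E; apply: (@addIn (totient (n * p))).
    rewrite E add1n; congr _.+1.
    have [m co nE] := pfactor_coprime pp n0.
    have l0 : (0 < logn p n)%N by rewrite logn_gt0 mem_primes pp n0.
    rewrite nE -mulnA -expnSr !totient_coprime ?coprimeXr //= 1?coprime_sym //.
    by rewrite !totient_pfactor //= -mulnA -(prednK l0) expnSr -!mulnA.
  exists ('Phi_n ^+ p.-1), v.
  by rewrite -exprSr prednK // -GE GQ Q1 mul1r.
have [z pz] := C_prim_root_exists n0.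
(* Here [z ^+ p] is again primitive of order n, so [G] vanishes at [z], while ['Phi_(n * p)] does
   not, [z] having order n. *)
have [Q' QE] : divides 'Phi_n Q.
  apply: (Cyclotomic_divides pz).
  have zp : n.-primitive_root (z ^+ p).
    by rewrite (prim_root_exp_coprime p pz) prime_coprime.
  have : poly_ev z G = 0.
    rewrite /poly_ev map_comp_poly map_polyXn horner_comp hornerXn.
    exact/rootP/map_Cyclotomic_root.
  rewrite GQ /poly_ev rmorphM /= hornerM => /eqP; rewrite mulf_eq0 => /orP[/eqP//|].
  have np0 : (0 < n * p)%N by rewrite muln_gt0 n0.
  move=> /(root_Cyclotomic_prim np0)/(prim_order_inj pz)/eqP.
  by rewrite -[X in X == _]muln1 eqn_pmul2l // => /eqP p1E; rewrite -p1E in p1.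
have Q'E : Q' = 1.
  have mQ' : Q' \is monic by rewrite -(monicMr _ mn) -QE.
  apply: monic_size1 => //; move: sG; rewrite GQ QE -mulrA.
  rewrite !size_Mmonic ?monic_neq0 ?monicMr // !size_Cyclotomic.
  suff -> : (totient n * p = totient (n * p) + totient n)%N by lia.
  rewrite totient_coprime 1?coprime_sym ?prime_coprime // (totient_prime pp).
  by rewrite -mulnSr prednK.
rewrite GQ QE Q'E mul1r in GE.
(* Modulo ['Phi_n] the congruence reads p v = 0, and p is cancellable modulo a monic polynomial. One
   factor ['Phi_n] can then be removed from both sides. *)
have [t vE] : divides 'Phi_n v.
  apply/dividesP => //.
  have /(congr1 (fun f : {poly int} => Pdiv.Ring.rmodp f 'Phi_n)) := GE.
  rewrite mulrC mulr_natr Pdiv.RingMonic.rmodpD // Pdiv.RingMonic.rmodp_mull //.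
  rewrite -(prednK p0) exprSr Pdiv.RingMonic.rmodp_mull // add0r prednK //.
  rewrite -scaler_nat Pdiv.RingMonic.rmodpZ // => /esym/eqP.
  by rewrite -mul_polyC mulf_eq0 polyC_eq0 pnatr_eq0 -leqn0 leqNgt p0 => /eqP.
exists ('Phi_n ^+ p.-2), t.
apply: (mulfI (monic_neq0 mn)); rewrite GE vE mulrDr -exprSr -exprS.
by rewrite (mulrC t) mulrA (_ : p.-2.+2 = p) //; lia.
Qed.

(** Every term in the expansion of (u B + v p)^(a + b) contains B^a or p^b. *)
Lemma pideal_exp p a b A B : pideal p B A ->
  exists u v, A ^+ (a + b) = u * B ^+ a + v * (p ^ b)%:R.
Proof.
move=> [u [v AE]]; elim: a b => [|a IHa] b.
  by exists (A ^+ b), 0; rewrite expr0 mulr1 mul0r addr0.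
elim: b => [|b [u1 [v1 IHb]]].
  by exists 0, (A ^+ (a.+1 + 0)); rewrite mul0r add0r expn0 mulr1.
have [u2 [v2 E2]] := IHa b.+1.
(* In one factor A = u B + v p, the B-part is multiplied by the case (a, b + 1) and the p-part by
   the case (a + 1, b). *)
exists (u * u2 + v * u1 * p%:R), (u * B * v2 + v * v1).
rewrite addnS exprS {1}AE mulrDl {1}addSnnS E2 IHb !exprS expnS.
rewrite natrM; move: (p ^ b)%:R p%:R (B ^+ a) => P p' S; ring.
Qed.

(** * Divisibility between (q)_n and powers of q^m - 1 *)

Lemma divides_qfact i j : (i <= j)%N -> divides (qfact i) (qfact j).
Proof.
elim: j => [|j IH]; first by rewrite leqn0 => /eqP ->; exists 1; rewrite mul1r.
rewrite leq_eqVlt => /orP[/eqP ->|]; first by exists 1; rewrite mul1r.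
by rewrite ltnS => /IH ij; rewrite qfactS; exact: divides_mulr.
Qed.

Lemma divides_XnM1 m n : divides ('X^m - 1) ('X^(m * n) - 1).
Proof.
by exists (\sum_(i < n) 'X^m ^+ i); rewrite exprM subrX1 [RHS]mulrC.
Qed.

(** The factors of index n, 2n, ..., mn are each divisible by q^n - 1. *)
Lemma divides_XnM1_qfact n m : (0 < n)%N ->
  divides (('X^n - 1) ^+ m) (qfact (n * m)).
Proof.
move=> n0; elim: m => [|m [q E]]; first by exists (qfact (n * 0)); rewrite mulr1.
have nm0 : (0 < n * m.+1)%N by rewrite muln_gt0 n0.
rewrite -(prednK nm0) qfactS prednK //.
have [|q1 ->] := @divides_qfact (n * m) (n * m.+1).-1.
  by rewrite -ltnS prednK // ltn_pmul2l.
have [q2 ->] := divides_XnM1 n m.+1.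
by exists (q1 * q * q2); rewrite E exprSr !mulrA; congr (_ * _); rewrite mulrAC.
Qed.

Lemma qfact_divides_XnM1 n :
  exists m, (0 < m)%N /\ divides (qfact n) (('X^m - 1) ^+ n).
Proof.
(* Each i from 1 to n divides n!, so each factor q^i - 1 divides q^(n!) - 1. *)
exists n`!; split; first exact: fact_gt0.
suff H i : (i <= n)%N -> divides (qfact i) (('X^(n`!) - 1) ^+ i) by exact: H.
elim: i => [_|i IH lin]; first by exists 1; rewrite mul1r /qfact big_geq.
have [q E] := IH (ltnW lin); rewrite qfactS (exprSr ('X^_ - 1)) E.
have /dvdnP[c ->] : (i.+1 %| n`!)%N by apply: dvdn_fact.
have := divides_XnM1 i.+1 c; rewrite (mulnC i.+1) => -[q' ->].
by exists (q * q'); rewrite -!mulrA; congr (_ * _); rewrite mulrCA.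
Qed.

(** * Divisibility in the Habiro ring *)

Lemma hseq_divides (x : habiro) k j : (k <= j)%N ->
  divides (qfact k) (x j - x k).
Proof.
elim: j => [|j IH]; first by rewrite leqn0 => /eqP ->; rewrite subrr; exists 0; rewrite mul0r.
rewrite leq_eqVlt => /orP[/eqP ->|]; first by rewrite subrr; exists 0; rewrite mul0r.
rewrite ltnS => kj; rewrite -[x j.+1](subrK (x j)) -addrA -[x j - x k]opprB.
apply: dividesB; last by have [q E] := IH kj; exists (- q); rewrite -opprB E mulNr.
apply: divides_trans (divides_qfact kj) _.
apply/dividesP; first exact: qfact_monic.
by rewrite (Pdiv.RingMonic.rmodpB (qfact_monic j)) -hseqP hseq_rem subrr.
Qed.

(** Once d divides (q)_k, the class of [x j] modulo d is the same for all j >= k; for such d this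
    says that x maps to 0 in Z[q]/(d). *)
Definition evdivides (d : {poly int}) (x : habiro) :=
  exists k, forall j, (k <= j)%N -> divides d (x j).

Lemma evdividesP d k (x : habiro) :
  divides d (qfact k) -> divides d (x k) -> evdivides d x.
Proof.
move=> dk dx; exists k => j /(hseq_divides x)/(divides_trans dk) [q E].
by have [q' E'] := dx; exists (q + q'); rewrite mulrDl -E -E' subrK.
Qed.

Lemma evdivides_pideal p c A B (x : habiro) : (1 < p)%N -> B \is monic ->
    (forall n, exists k, divides (B ^+ n) (qfact k)) -> pideal p B (A ^+ c) ->
  (forall n, evdivides (A ^+ n) x) -> forall n, evdivides (B ^+ n) x.
Proof.
move=> p1 mB Bq AB Ax n; have [k Bk] := Bq n.
apply: (evdividesP Bk); apply: divides_adic => [|s]; first exact: monic_exp.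
have [u [v E]] := pideal_exp n s AB.
have [i /(_ _ (leq_maxr k i)) [q Ei]] := Ax (c * (n + s))%N.
have [t Et] := divides_trans Bk (hseq_divides x (leq_maxl k i)).
(* A large power of [A] lies in the ideal (B^n, p^s); [t] accounts for replacing [x (maxn k i)] by
   [x k]. *)
exists (p ^ s)%N, (q * u - t), (q * v); split; first exact: ltn_expl.
rewrite exprM E in Ei.
by rewrite -[LHS](subKr (x (maxn k i))) Et Ei mulrBl mulrDr !mulrA addrAC.
Qed.

Lemma pideal_Cyclotomic_pexp n p b : (0 < n)%N -> prime p ->
  pideal p 'Phi_n 'Phi_(n * p ^ b.+1).
Proof.
move=> n0 pp; elim: b => [|b IH]; first by rewrite expn1; exact: pideal_Cyclotomic.
apply: pideal_trans IH _; rewrite (expnSr _ b.+1) mulnA; apply: pideal_Cyclotomic => //.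
by rewrite muln_gt0 n0 expn_gt0 prime_gt0.
Qed.

Lemma poly_evM (F : numClosedFieldType) (z : F) p q :
  poly_ev z (p * q) = poly_ev z p * poly_ev z q.
Proof. by rewrite /poly_ev rmorphM hornerM. Qed.

Lemma poly_ev_Cyclotomic_neq0 (F : numClosedFieldType) m n (z : F) :
  (0 < n < m)%N -> m.-primitive_root z -> poly_ev z 'Phi_n != 0.
Proof.
move=> /andP[n0 nm] pz; apply/eqP => /rootP/(root_Cyclotomic_prim n0) pn.
by rewrite (prim_order_inj pn pz) ltnn in nm.
Qed.

Lemma Cyclotomic_divides_XnM1 n : (0 < n)%N -> divides 'Phi_n ('X^n - 1).
Proof.
move=> n0; rewrite -(prod_Cyclotomic n0) (big_rem n) /= -?dvdn_divisors //.
by exists (\prod_(d <- rem n (divisors n)) 'Phi_d); rewrite mulrC.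
Qed.

Lemma evdivides_Cyclotomic_Xsub1 (x : habiro) m t : (0 < m)%N ->
  (forall e, evdivides ('Phi_m ^+ e) x) -> evdivides (('X^1 - 1) ^+ t) x.
Proof.
elim/ltn_ind: m t => m IH t m0 Hm.
have [m1|m1] := leqP m 1.
  have mE : m = 1%N by apply/eqP; rewrite eqn_leq m1.
  by rewrite -prod_Cyclotomic // big_seq1 -mE.
have pp := pdiv_prime m1; have p1 := prime_gt1 pp.
have m'0 : (0 < m %/ pdiv m)%N by rewrite divn_gt0 ?prime_gt0 // pdiv_leq.
apply: (IH (m %/ pdiv m)%N) => //; first by rewrite ltn_Pdiv.
(* Descend by the smallest prime factor of m; no power of ['Phi_m] has to be taken, whence c = 1. *)
apply: (evdivides_pideal p1 (Cyclotomic_monic _) (c := 1) (A := 'Phi_m)) => //.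
  move=> e; exists (m %/ pdiv m * e)%N.
  apply: divides_trans (divides_XnM1_qfact _ m'0).
  exact/divides_exp/Cyclotomic_divides_XnM1.
by have := pideal_Cyclotomic m'0 pp; rewrite divnK ?pdiv_dvd.
Qed.

Lemma evdivides_XnM1 (x : habiro) m t : (0 < m)%N ->
  (forall e, evdivides (('X^1 - 1) ^+ e) x) -> evdivides (('X^m - 1) ^+ t) x.
Proof.
elim/ltn_ind: m t => m IH t m0 H1.
have [m1|m1] := leqP m 1.
  have -> : m = 1%N by apply/eqP; rewrite eqn_leq m1.
  exact: H1.
have pp := pdiv_prime m1; have p1 := prime_gt1 pp.
have m'0 : (0 < m %/ pdiv m)%N by rewrite divn_gt0 ?prime_gt0 // pdiv_leq.
(* Climb by the smallest prime factor p of m, with c = p because it is the p-th power of q^(m/p) - 1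
   that lies in (p, q^m - 1). *)
apply: (evdivides_pideal p1 _ _ (c := pdiv m) (A := 'X^(m %/ pdiv m) - 1)).
- by rewrite -[1]/(1%:P) monicXnsubC.
- by move=> e; exists (m * e)%N; exact: divides_XnM1_qfact.
- by have := pideal_XnM1 (m %/ pdiv m) pp; rewrite divnK ?pdiv_dvd.
by move=> e; apply: IH => //; rewrite ltn_Pdiv.
Qed.

(** * Elements vanishing at roots of unbounded order n p^b *)

Section Vanishing.
Variables (F : numClosedFieldType) (n : nat) (x : habiro).
Hypothesis n_gt0 : (0 < n)%N.
Hypothesis ev0 : forall B, exists m p b (z : F),
  [/\ (B < m)%N, prime p, m = (n * p ^ b)%N, m.-primitive_root z & ev z x = 0].

(* The polynomial d is a product of s cyclotomic polynomials of orders
   n * p_i ^ b_i at which x vanishes, and N is the product of the p_i. *)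
Lemma vanishing_divisor s : exists B d N,
  [/\ (n <= B)%N, (s < N)%N, pideal N 'Phi_n d,
      (forall m (z : F), (B < m)%N -> m.-primitive_root z -> poly_ev z d != 0) &
      (forall j t q, (B <= j)%N -> x j = q * 'Phi_n ^+ t -> divides d q)].
Proof.
elim: s => [|s [B [d [N [nB sN [u [v dE]] d0 dx]]]]].
  exists n, 1, 1%N; split=> //; first by exists 0, 1; rewrite mul0r add0r mulr1.
    by move=> m z _ _; rewrite /poly_ev rmorph1 hornerC oner_eq0.
  by move=> j t q _ _; exists q; rewrite mulr1.
have [m [p [b [z [Bm pp mE pz xz]]]]] := ev0 B.
have [u' [v' E]] : pideal p 'Phi_n 'Phi_m.
  (* The exponent 0 would give m = n, contrary to n <= B < m. *)
  case: b mE => [|b] mE; last by rewrite mE; exact: pideal_Cyclotomic_pexp.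
  by move: Bm; rewrite mE muln1 ltnNge nB.
have m0 : (0 < m)%N by apply: leq_trans Bm.
exists m, (d * 'Phi_m), (N * p)%N; split.
- exact: leq_trans nB (ltnW Bm).
- by have := prime_gt1 pp; nia.
- exists (u * 'Phi_m + v * u' * N%:R), (v * v').
  by rewrite dE mulrDl [in X in _ + X = _]E natrM; ring.
- move=> m' z' mm' pz'; rewrite poly_evM mulf_neq0 ?(d0 m') //.
    exact: ltn_trans mm'.
  by apply: (poly_ev_Cyclotomic_neq0 _ pz'); rewrite m0.
move=> j t q mj xE; have Bj : (B <= j)%N by apply: leq_trans mj; exact: ltnW.
(* Since [z] has order m > B >= n, neither [d] nor ['Phi_n] vanishes at [z]; hence [q'] does, and
   ['Phi_m] divides it. *)
have [q' qE] := dx j t q Bj xE.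
have zZ : is_root_of_unity z by exists m => //; exact: prim_expr_order.
have oz : root_order z = m := prim_order_inj (root_orderP zZ) pz.
move: xz; rewrite (@ev_eq _ z x j) ?oz // xE qE !poly_evM => /eqP.
have nm : (0 < n < m)%N by rewrite n_gt0 (leq_ltn_trans nB).
rewrite !mulf_eq0 (negPf (d0 _ _ Bm pz)) orbF [X in _ || X](_ : _ = false).
  rewrite orbF => /eqP/(Cyclotomic_divides pz)[q'' ->].
  by exists q''; rewrite -mulrA (mulrC d).
apply/negbTE; rewrite /poly_ev rmorphXn horner_exp expf_neq0 //.
exact: poly_ev_Cyclotomic_neq0 pz.
Qed.

Lemma evdivides_Cyclotomic t : evdivides ('Phi_n ^+ t) x.
Proof.
elim: t => [|t [k0 xk]]; first by exists 0%N => j _; exists (x j); rewrite mulr1.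
pose k := maxn k0 (n * t.+1).
have dk : divides ('Phi_n ^+ t.+1) (qfact k).
  apply: divides_trans (divides_qfact (leq_maxr _ _)).
  apply: divides_trans (divides_XnM1_qfact _ n_gt0).
  exact/divides_exp/Cyclotomic_divides_XnM1.
apply: (evdividesP dk); have [q qE] := xk k (leq_maxl _ _).
suff [q' q'E] : divides 'Phi_n q.
  by exists q'; rewrite qE q'E exprS mulrA.
apply: (divides_adic (Cyclotomic_monic n)) => s.
have [B [d [N [_ sN [u [v dE]] _ dx]]]] := vanishing_divisor s.
(* Divisibility by [d] is visible only from index [B] on; [c] corrects for the passage from [x j]
   back to [x k], a multiple of ['Phi_n ^+ t.+1]. *)
have kj := leq_maxl k B; have Bj := leq_maxr k B; set j := maxn k B in kj Bj.
have [qj qjE] := xk j (leq_trans (leq_maxl _ _) kj).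
have [w wE] := dx _ _ _ Bj qjE.
have [c cE] := divides_trans dk (hseq_divides x kj).
exists N, (w * u - c), (w * v); split=> //.
apply: (mulIf (monic_neq0 (monic_exp t (Cyclotomic_monic n)))).
rewrite -qE -[LHS](subKr (x j)) cE qjE wE exprS dE; ring.
Qed.

Lemma habiro_eq0 : x = 0.
Proof.
(* The k-th entry is its own remainder modulo (q)_k, so it is zero once (q)_k divides it. *)
apply: habiroP => k; rewrite [RHS]Pdiv.CommonRing.rmod0p -hseq_rem.
have [m [m0 km]] := qfact_divides_XnM1 k.
have x1 e := evdivides_Cyclotomic_Xsub1 e n_gt0 evdivides_Cyclotomic.
have [i /(_ _ (leq_maxr k i)) xi] := evdivides_XnM1 k m0 x1.
apply/dividesP; first exact: qfact_monic.
rewrite -[hseq x k](subKr (x (maxn k i))).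
apply: dividesB (divides_trans km xi) _.
exact: hseq_divides (leq_maxl k i).
Qed.

End Vanishing.

(** * Adjacent roots and determination by values *)

Lemma adjacent_order (F : numClosedFieldType) (z w : F) m n :
  Defs.adjacent z w -> m.-primitive_root z -> n.-primitive_root w -> (n < m)%N ->
  exists p b, prime p /\ m = (n * p ^ b)%N.
Proof.
move=> [p [k [pp _ pu]]] pz pw nm; exists p.
have m0 := prim_order_gt0 pz; have n0 := prim_order_gt0 pw.
have P0 : (0 < p ^ k)%N by rewrite expn_gt0 prime_gt0.
have w0 : w != 0.
  by apply/eqP => w0; move/eqP: (prim_expr_order pw);
    rewrite w0 expr0n gtn_eqF // eq_sym oner_eq0.
have zwP : z ^+ (p ^ k) = w ^+ (p ^ k).
  by rewrite -[z](divfK w0) exprMn (prim_expr_order pu) mul1r.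
have mP : (m %| n * p ^ k)%N.
  by rewrite (prim_order_dvd pz) mulnC exprM zwP -exprM mulnC exprM
    (prim_expr_order pw) expr1n.
have nP : (n %| m * p ^ k)%N.
  by rewrite (prim_order_dvd pw) mulnC exprM -zwP -exprM mulnC exprM
    (prim_expr_order pz) expr1n.
have p'P : ((p ^ k)`_p^' = 1)%N.
  by apply: part_p'nat; rewrite pnatNK pnatX pnat_id.
(* As m and n divide each other up to powers of p, they differ only in their p-parts, which n < m
   then orders. *)
have E : (m`_p^' = n`_p^')%N.
  apply/eqP; rewrite eqn_dvd.
  have := partn_dvd (p^')%N _ mP; have := partn_dvd (p^')%N _ nP.
  by rewrite !partnM // p'P !muln1 !muln_gt0 m0 n0 P0 => -> // ->.
have p'0 : (0 < n`_p^')%N by apply: part_gt0.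
move: nm; rewrite -(partnC p m0) -(partnC p n0) E !p_part ltn_pmul2r //.
rewrite ltn_exp2l ?prime_gt1 // => /ltnW ab.
by exists (logn p m - logn p n)%N; split=> //; rewrite mulnAC -expnD subnKC.
Qed.

Lemma prim_root_exists (F : numClosedFieldType) n : (0 < n)%N ->
  exists z : F, n.-primitive_root z.
Proof.
move=> n0; have /closed_rootP[z rz] : size (map_poly intr 'Phi_n : {poly F}) != 1.
  rewrite size_map_inj_poly ?size_Cyclotomic //; last exact: intr_inj.
  by rewrite eqSS -lt0n totient_gt0.
by exists z; exact: root_Cyclotomic_prim.
Qed.

(** The roots of order 2^B accumulate at 1 in the sense of adjacency, so the vanishing criterion
    applies with n = 1. *)
Lemma ev_eq_habiro (F : numClosedFieldType) (x y : habiro) :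
  (forall z : F, is_root_of_unity z -> ev z x = ev z y) -> x = y.
Proof.
move=> xy; apply/eqP; rewrite -subr_eq0; apply/eqP.
apply: (@habiro_eq0 F 1%N) => // B.
have [z pz] : exists z : F, (2 ^ B).-primitive_root z.
  by apply: prim_root_exists; rewrite expn_gt0.
exists (2 ^ B)%N, 2, B, z; split=> //; [exact: ltn_expl | by rewrite mul1n |].
apply: (addIr (ev z y)); rewrite -evD subrK add0r; apply: xy.
by exists (2 ^ B)%N; [rewrite expn_gt0|exact: prim_expr_order].
Qed.

Lemma ev_eq_limit_point (F : numClosedFieldType) (Z : set F) (w : F) (x y : habiro) :
  (forall z, Z z -> is_root_of_unity z) -> adjacency_limit_point Z w ->
  (forall z, Z z -> ev z x = ev z y) -> x = y.
Proof.
move=> ZU [wU Zinf] xy; apply/eqP; rewrite -subr_eq0; apply/eqP.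
have pw := root_orderP wU; set n := root_order w in pw.
apply: (@habiro_eq0 F n) => [|B]; first exact: prim_order_gt0 pw.
have [z [Zz zw Bz]] : exists z, [/\ Z z, Defs.adjacent z w & (maxn n B < root_order z)%N].
  apply: contra_notP Zinf => noz.
  (* All roots of unity of order at most N are among the finitely many roots of X^(N!) - 1, so an
     infinite set of them has unbounded orders. *)
  pose P : {poly F} := 'X^((maxn n B)`!) - 1.
  have [rs Prs] := closed_field_poly_normal P.
  have P1 : lead_coef P = 1.
    by apply/eqP; rewrite -[_ == _]/(P \is monic) /P -[1]/(1%:P) monicXnsubC // fact_gt0.
  apply: (@sub_finite_set _ _ [set` rs]); last exact: finite_seq.
  move=> z [Zz zw] /=; rewrite -root_prod_XsubC.
  rewrite P1 scale1r in Prs; rewrite -Prs /root !hornerE subr_eq0.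
  have pz := root_orderP (ZU z Zz).
  rewrite -(prim_order_dvd pz); apply: dvdn_fact.
  rewrite (prim_order_gt0 pz) leqNgt; apply/negP => lt; apply: noz.
  by exists z.
have pz := root_orderP (ZU z Zz).
have [|p [b [pp mE]]] := adjacent_order zw pz pw.
  by apply: leq_ltn_trans Bz; exact: leq_maxl.
exists (root_order z), p, b, z; split=> //.
  by apply: leq_ltn_trans Bz; exact: leq_maxr.
by apply: (addIr (ev z y)); rewrite -evD subrK add0r; apply: xy.
Qed.

Theorem theorem1p4 (R : realType) (J : integral_homology_sphere R -> habiro)
    (hJ : unified_wrt J) :
  (forall M M' : integral_homology_sphere R,
     J M = J M' <->
     (forall z : R[i], is_root_of_unity z -> wrt M z = wrt M' z)) /\
  (forall Z' : set R[i],
     (forall z, Z' z -> is_root_of_unity z) ->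
     infinite_set Z' ->
     (exists w, adjacency_limit_point Z' w) ->
     forall M M' : integral_homology_sphere R,
       (forall z, Z' z -> wrt M z = wrt M' z) ->
       J M = J M' /\
       (forall z : R[i], is_root_of_unity z -> wrt M z = wrt M' z)).
Proof.
have det M M' : J M = J M' ->
    forall z : R[i], is_root_of_unity z -> wrt M z = wrt M' z.
  by move=> JE z zU; rewrite -!hJ // JE.
split=> [M M'|Z' ZU _ [w wlim] M M' wE].
  split=> [|wE]; first exact: det.
  by apply: (@ev_eq_habiro R[i]) => z zU; rewrite !hJ ?wE.
suff JE : J M = J M' by split=> //; exact: det.
by apply: (ev_eq_limit_point ZU wlim) => z Zz; rewrite !hJ ?wE //; exact: ZU.
Qed.
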